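(* Let $\mathbb{X}$ be a two-dimensional real Banach space ($\mathbb{R}^2$ with some norm) such that the unit sphere $S_{\mathbb{X}}$ is a regular polygon with $4n+2$ vertices, where $n \in \mathbb{N}$. Then $\mathbb{X}$ is a Radon plane.
   Context: Here $\mathbb{N} = \{1, 2, 3, \dots\}$. A two-dimensional real Banach space $\mathbb{X}$ is identified with $\mathbb{R}^2$ equipped with some norm $\|\cdot\|$; $S_{\mathbb{X}} = \{x : \|x\| = 1\}$. $S_{\mathbb{X}}$ is a polygon if the unit ball has only finitely many extreme points (these are its vertices). $S_{\mathbb{X}}$ is a regular polygon if all its edges have the same length with respect to the usual (Euclidean) metric on $\mathbb{R}^2$ and all interior angles are equal in measure. Birkhoff-James orthogonality: $x \perp_B y$ means $\|x + \lambda y\| \ge \|x\|$ for all $\lambda \in \mathbb{R}$. $\mathbb{X}$ is a Radon plane if $\perp_B$ is symmetric, i.e. $x \perp_B y$ implies $y \perp_B x$ for all $x, y \in \mathbb{X}$. *)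

(* Defs.v *)
From HB Require Import structures.
From mathcomp Require Import all_boot all_order all_algebra.
From mathcomp Require Import all_classical all_reals all_analysis.

Set Implicit Arguments.
Unset Strict Implicit.
Unset Printing Implicit Defensive.

Import Order.TTheory GRing.Theory Num.Theory.

Local Open Scope classical_set_scope.
Local Open Scope ring_scope.

(* The plane R^2 is 'rV[R]_2. MathComp-Analysis equips that type with the sup
   norm `|x|; it plays no role below. The norm of the Banach space is the
   function N, and the Euclidean norm of R^2 is [euclid_norm]. *)

Section Plane.
Context {R : realType}.
Implicit Types (N : 'rV[R]_2 -> R) (u v w x y : 'rV[R]_2).

(* Same axioms as the library factory Lmodule_isNormed; nonnegativity follows
   from 0 = N (x - x) <= N x + N (- x) = 2 * N x. *)
Record is_norm N : Prop := IsNorm {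
  is_normD : forall x y, N (x + y) <= N x + N y;
  is_normZ : forall (a : R) x, N (a *: x) = `|a| * N x;
  is_norm_eq0 : forall x, N x = 0 -> x = 0 }.

Definition unit_ball N : set 'rV[R]_2 := [set x | N x <= 1].

Definition unit_sphere N : set 'rV[R]_2 := [set x | N x = 1].

Definition birkhoff_james_orthogonal N x y : Prop :=
  forall l : R, N x <= N (x + l *: y).

Definition radon_plane N : Prop :=
  forall x y,
    birkhoff_james_orthogonal N x y -> birkhoff_james_orthogonal N y x.

Definition segment u v : set 'rV[R]_2 :=
  [set (1 - t) *: u + t *: v | t in `[0, 1]%classic].

Definition extreme_points (A : set 'rV[R]_2) : set 'rV[R]_2 :=
  [set x | A x /\
    forall y z (t : R), A y -> A z -> 0 < t < 1 ->
      x = (1 - t) *: y + t *: z -> y = x /\ z = x].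

Definition vertices N : set 'rV[R]_2 := extreme_points (unit_ball N).

Definition is_polygon N : Prop := finite_set (vertices N).

(* The segment [u, v] is an edge. A segment contained in the sphere lies on a
   single face of the ball, so two distinct vertices joined inside the sphere
   are necessarily the two endpoints of one side of the polygon. *)
Definition edge N u v : Prop :=
  [/\ vertices N u, vertices N v, u <> v & segment u v `<=` unit_sphere N].

Definition euclid_dot u v : R := \sum_(i < 2) u 0 i * v 0 i.

Definition euclid_norm u : R := Num.sqrt (euclid_dot u u).

(* Measure, in [0, pi], of the angle with apex v and sides [v, u], [v, w]; as the
   unit ball is convex, this is the interior angle when these are its two edges
   at v. *)
Definition angle u v w : R :=
  acos (euclid_dot (u - v) (w - v)
        / (euclid_norm (u - v) * euclid_norm (w - v))).

Definition is_regular_polygon N : Prop :=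
  [/\ is_polygon N,
      exists len : R, forall u v, edge N u v -> euclid_norm (v - u) = len
    & exists a : R, forall u v w,
        edge N v u -> edge N v w -> u <> w -> angle u v w = a].

End Plane.

(* Main.v *)
Require Import Defs.
From mathcomp Require Import all_boot all_order all_algebra.
From mathcomp Require Import all_classical all_reals all_analysis.
From mathcomp Require Import ring lra zify.

Set Implicit Arguments.
Unset Strict Implicit.
Unset Printing Implicit Defensive.

Import Order.TTheory GRing.Theory Num.Theory.

Local Open Scope classical_set_scope.
Local Open Scope ring_scope.
Local Open Scope card_scope.

(* Let [wedge] be the area form of the plane. The vertices, in counterclockwise
   order, are v_k = Q^k v_0 for one rotation Q: equal sides and equal angles give
   e_(k+1) = Q e_k for the edges e_k = v_(k+1) - v_k, so Q v_k - v_(k+1) is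
   constant, and it vanishes because the ball is symmetric. As Q has order 4n+2,
   Q^(2n+1) = -1, so P = Q^(n+1) satisfies P^2 = -Q and
   Q - 1 = -(P^2 + 1) = -2a P with 2a the trace of P: every edge is parallel to a
   vertex. Hence N y, the maximum of wedge(y, e_k) up to a constant, is also a
   constant times the maximum of wedge(y, v) over the vertices v, that is, the
   norm of wedge(., y). Thus x is orthogonal to y iff |wedge(x, y)| = C N(x) N(y),
   which is symmetric. *)

(** * Area form, rotations and cyclic sequences in the plane *)

Section PlaneGeometry.
Context {R : realType}.
Implicit Types (u v w x y z p q : 'rV[R]_2) (a b c s t : R).

Lemma row2P x y : x 0 0 = y 0 0 -> x 0 1 = y 0 1 -> x = y.
Proof.
move=> e0 e1; apply/rowP => i.
by have [->|->] : i = 0 \/ i = 1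
  by case: i => [[|[|//]] ?]; [left|right]; apply: val_inj.
Qed.

Definition wedge x y : R := x 0 0 * y 0 1 - x 0 1 * y 0 0.

Definition quarter_turn x : 'rV[R]_2 :=
  \row_j (if j == 0 then - x 0 1 else x 0 0).

(** Multiplication by the complex number a + bi; a genuine rotation when [a ^+ 2 + b ^+ 2 = 1]. *)
Definition rotation a b x : 'rV[R]_2 := a *: x + b *: quarter_turn x.

Lemma euclid_dotE x y : euclid_dot x y = x 0 0 * y 0 0 + x 0 1 * y 0 1.
Proof.
rewrite /euclid_dot !big_ord_recl big_ord0 addr0.
by rewrite (_ : lift ord0 ord0 = 1) //; apply: val_inj.
Qed.

Lemma wedge0l y : wedge 0 y = 0. Proof. by rewrite /wedge !mxE; ring. Qed.
Lemma wedgexx x : wedge x x = 0. Proof. by rewrite /wedge; ring. Qed.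
Lemma wedgeC x y : wedge x y = - wedge y x.
Proof. by rewrite /wedge; ring. Qed.
Lemma wedgeDl x y z : wedge (x + y) z = wedge x z + wedge y z.
Proof. by rewrite /wedge !mxE; ring. Qed.
Lemma wedgeDr x y z : wedge z (x + y) = wedge z x + wedge z y.
Proof. by rewrite /wedge !mxE; ring. Qed.
Lemma wedgeNl x y : wedge (- x) y = - wedge x y.
Proof. by rewrite /wedge !mxE; ring. Qed.
Lemma wedgeNr x y : wedge x (- y) = - wedge x y.
Proof. by rewrite /wedge !mxE; ring. Qed.
Lemma wedgeZl a x y : wedge (a *: x) y = a * wedge x y.
Proof. by rewrite /wedge !mxE; ring. Qed.
Lemma wedgeZr a x y : wedge x (a *: y) = a * wedge x y.
Proof. by rewrite /wedge !mxE; ring. Qed.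
Definition wedgeE := (wedgeDl, wedgeDr, wedgeNl, wedgeNr, wedgeZl, wedgeZr,
  wedgexx).

Lemma wedge_neq0l x y : wedge x y != 0 -> x != 0.
Proof. by apply: contraNneq => ->; rewrite wedge0l. Qed.

(** Cramer's rule. *)
Lemma wedge_decomposition p q x : wedge p q != 0 ->
  x = (wedge x q / wedge p q) *: p + (wedge p x / wedge p q) *: q.
Proof.
move=> pq; apply: row2P; rewrite !mxE; move: pq; rewrite /wedge => pq; field;
  exact: pq.
Qed.

Lemma euclid_dot_gt0 x : x != 0 -> 0 < euclid_dot x x.
Proof.
move=> x0; rewrite euclid_dotE -!expr2 lt0r addr_ge0 ?sqr_ge0 // andbT.
rewrite paddr_eq0 ?sqr_ge0 // !sqrf_eq0; apply: contra x0 => /andP[/eqP e0 /eqP e1].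
by apply/eqP/row2P; rewrite mxE.
Qed.

Lemma parallel_wedge x y : x != 0 -> wedge x y = 0 ->
  y = (euclid_dot x y / euclid_dot x x) *: x.
Proof.
move=> /euclid_dot_gt0/lt0r_neq0; rewrite !euclid_dotE /wedge => x0 /eqP.
rewrite subr_eq0 => /eqP xy.
by apply: row2P; rewrite mxE; apply: (mulfI x0); rewrite mulrA mulrCA divff //;
  [ring: xy|ring: xy].
Qed.

Lemma wedge_quarter_turn x : wedge x (quarter_turn x) = euclid_dot x x.
Proof. by rewrite euclid_dotE /wedge !mxE /=; ring. Qed.

(** The coefficients are the real and imaginary parts of the complex quotient y / x. *)
Lemma dot_wedge_rotation x y : x != 0 ->
  y = rotation (euclid_dot x y / euclid_dot x x) (wedge x y / euclid_dot x x) x.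
Proof.
move=> /euclid_dot_gt0/lt0r_neq0; rewrite !euclid_dotE => x0.
by apply: row2P; rewrite !mxE /= /wedge; field; exact: x0.
Qed.

Lemma rotation_comp a b a' b' x :
  rotation a b (rotation a' b' x) = rotation (a * a' - b * b') (a * b' + b * a') x.
Proof. by apply: row2P; rewrite !mxE /=; ring. Qed.

Lemma rotationD a b x y : rotation a b (x + y) = rotation a b x + rotation a b y.
Proof. by apply: row2P; rewrite !mxE /=; ring. Qed.

Lemma rotationN a b x : rotation a b (- x) = - rotation a b x.
Proof. by apply: row2P; rewrite !mxE /=; ring. Qed.

Lemma wedge_rotation a b x y : a ^+ 2 + b ^+ 2 = 1 ->
  wedge (rotation a b x) (rotation a b y) = wedge x y.
Proof.
by move=> ab; rewrite -[RHS]mul1r -ab /wedge !mxE /=; ring.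
Qed.

Lemma lagrange_identity x y :
  wedge x y ^+ 2 + euclid_dot x y ^+ 2 = euclid_dot x x * euclid_dot y y.
Proof. by rewrite !euclid_dotE /wedge; ring. Qed.

Lemma iter_rotation c s k : c ^+ 2 + s ^+ 2 = 1 ->
  exists a b, a ^+ 2 + b ^+ 2 = 1 /\
    forall x, iter k (rotation c s) x = rotation a b x.
Proof.
move=> cs; elim: k => [|k [a [b [ab IH]]]].
  exists 1, 0; split => [|x]; first by ring.
  by apply: row2P; rewrite !mxE /=; ring.
exists (c * a - s * b), (c * b + s * a); split => [|x].
  by rewrite -[1]mulr1 -{1}cs -ab; ring.
by rewrite iterS IH rotation_comp.
Qed.

Lemma rotation_opp a b x : x != 0 ->
  rotation a b x = - x -> a = -1 /\ b = 0.
Proof.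
move=> x0 e.
have := congr1 (wedge x) e.
have := congr1 (euclid_dot x) e.
rewrite !euclid_dotE !mxE /= /wedge !mxE /=.
move=> e1 e2; have := euclid_dot_gt0 x0; rewrite euclid_dotE => s0.
split; apply: (mulIf (lt0r_neq0 s0)); lra.
Qed.

(* A cyclic sequence that always turns counterclockwise sweeps every direction:
   otherwise it stays in an open half-plane, where the slope is monotone. *)
Lemma cyclic_sweep (A : nat -> 'rV[R]_2) r y : (0 < r)%N ->
  (forall k, A (k + r)%N = A k) -> (forall k, 0 < wedge (A k) (A k.+1)) ->
  y != 0 -> exists k, wedge (A k) y >= 0 /\ wedge (A k.+1) y < 0.
Proof.
move=> r0 per turn y0; apply: contrapT => nocross.
have up k : wedge (A k) y >= 0 -> wedge (A k.+1) y >= 0.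
  move=> h; rewrite leNgt; apply/negP => h'; apply: nocross; by exists k.
have perM j k : A (k + j * r)%N = A k.
  by elim: j => [|j IH]; rewrite ?mul0n ?addn0 // mulSn [(r + _)%N]addnC addnA per.
(* Periodicity lets [up] reach every index, earlier ones included. *)
have all_ge0 k0 k : wedge (A k0) y >= 0 -> wedge (A k) y >= 0.
  move=> h; rewrite -(perM k0 k).
  have: (k0 <= k + k0 * r)%N by apply: leq_trans (leq_addl _ _); rewrite leq_pmulr.
  by elim: (k + _)%N => [|m IH]; [rewrite leqn0 => /eqP <-|
    rewrite leq_eqVlt => /predU1P[<- //|/IH/up]].
have same k : 0 < wedge (A k) y * wedge (A k.+1) y.
  have [h|h] := leP 0 (wedge (A k) y); last first.
    by rewrite nmulr_rgt0 // ltNge; apply/negP => /all_ge0 - /(_ k); rewrite leNgt h.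
  (* If [A j] were a multiple of [y], the turns before and after it would put its neighbours
     strictly on opposite sides of the line of [y]. *)
  have pos j : 0 < wedge (A j) y.
    rewrite lt_def (all_ge0 _ _ h) andbT; apply/eqP => jy.
    have yj : wedge y (A j) = 0 by rewrite wedgeC jy oppr0.
    have [c Aj] : exists c, A j = c *: y by eexists; exact: parallel_wedge yj.
    have := turn j; rewrite Aj wedgeZl wedgeC mulrN oppr_gt0 => t1.
    have := turn (j + r.-1)%N; rewrite -addnS prednK // per Aj wedgeZr => t2.
    have := all_ge0 _ j.+1 h; have := all_ge0 _ (j + r.-1)%N h.
    by have [c0|c0] := leP 0 c; nra.
  by rewrite mulr_gt0.
(* Each turn strictly increases the slope, against its periodicity. *)
pose slope k := euclid_dot (A k) y / wedge (A k) y.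
have incr k : slope k < slope k.+1.
  have := same k; have := turn k; have := euclid_dot_gt0 y0.
  rewrite /slope; set a := A k; set b := A k.+1 => y1 ab pr.
  have /andP[a0 b0] : (wedge a y != 0) && (wedge b y != 0).
    by rewrite -negb_or -mulf_eq0 gt_eqF.
  rewrite -subr_gt0.
  have -> : euclid_dot b y / wedge b y - euclid_dot a y / wedge a y =
     wedge a b * euclid_dot y y / (wedge a y * wedge b y).
    apply: (mulIf (lt0r_neq0 pr)); rewrite divfK ?lt0r_neq0 //.
    move: a0 b0 ; rewrite !euclid_dotE /wedge => a0 b0; field.
    by rewrite a0 b0.
  by rewrite divr_gt0 // mulr_gt0.
have : slope 0%N < slope r.
  have mono : {homo slope : i j / (i < j)%N >-> i < j}.
    by apply: homo_ltn => //; exact: lt_trans.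
  exact: mono.
by rewrite /slope -[in A r](add0n r) per ltxx.
Qed.

End PlaneGeometry.

(** * Supporting lines and faces of the unit ball *)

Section NormedPlane.
Context {R : realType} (N : 'rV[R]_2 -> R) (normN : is_norm N).
Implicit Types (u v w x y z p q : 'rV[R]_2) (a b t : R).

Lemma norm_opp x : N (- x) = N x.
Proof. by rewrite -scaleN1r is_normZ // normrN1 mul1r. Qed.

Lemma norm_zero : N 0 = 0.
Proof. by rewrite -(scale0r 0) is_normZ // normr0 mul0r. Qed.

Lemma norm_ge0 x : 0 <= N x.
Proof.
have := is_normD normN x (- x); rewrite subrr norm_zero norm_opp; lra.
Qed.

Lemma norm_gt0 x : x != 0 -> 0 < N x.
Proof.
by move=> /eqP x0; rewrite lt0r norm_ge0 andbT; apply/eqP => /(is_norm_eq0 normN).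
Qed.

Lemma norm_pos_scale a x : 0 <= a -> N (a *: x) = a * N x.
Proof. by move=> a0; rewrite is_normZ // ger0_norm. Qed.

Lemma norm_comb a b x y : 0 <= a -> 0 <= b ->
  N (a *: x + b *: y) <= a * N x + b * N y.
Proof. by move=> a0 b0; rewrite -!norm_pos_scale //; exact: is_normD. Qed.

(** The admissible [s] form a bounded set, and the triangle inequality shows that its supremum is
    attained. *)
Lemma last_ball_point x z : N x <= 1 -> z != 0 ->
  exists2 s, N (x + s *: z) <= 1 & forall s', N (x + s' *: z) <= 1 -> s' <= s.
Proof.
move=> x1 z0; pose E := [set s | N (x + s *: z) <= 1].
have Nz := norm_gt0 z0.
have ubE : has_ubound E.
  exists (2 / N z) => s Es; rewrite ler_pdivlMr // (le_trans (y := `|s| * N z)) //.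
    by rewrite ler_wpM2r ?ler_norm // ltW.
  rewrite -is_normZ // -[s *: z](addKr x) (le_trans (is_normD normN _ _)) //.
  by rewrite norm_opp; apply: lerD.
have supE : has_sup E by split => //; exists 0; rewrite /E /= scale0r addr0.
exists (sup E) => [|s Es]; last exact: ub_le_sup.
apply/ler_addgt0Pr => e e0.
have [s Es lts] := sup_adherent (divr_gt0 e0 Nz) supE.
have les : s <= sup E by exact: ub_le_sup.
rewrite (_ : x + _ = (x + s *: z) + (sup E - s) *: z); last first.
  by rewrite -addrA -scalerDl; congr (_ + _ *: _); ring.
rewrite (le_trans (is_normD normN _ _)) // lerD //.
rewrite norm_pos_scale ?subr_ge0 // -ler_pdivlMr //; lra.
Qed.

(** By convexity, a chord with an inner point of norm 1 lies on a line that supports the ball;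
    homogeneity turns this into a bound for every [p]. *)
Lemma supporting_line x y y' t (z := y' - y) :
  N x = 1 -> N y <= 1 -> N y' <= 1 -> 0 < t < 1 ->
  x = (1 - t) *: y + t *: y' -> z != 0 ->
  wedge x z != 0 /\ forall p, `|wedge p z| <= `|wedge x z| * N p.
Proof.
move=> x1 y1 y'1 /andP[t0 t1] xE z0.
have yE : y = x - t *: z by rewrite xE /z; apply: row2P; rewrite !mxE; ring.
have y'E : y' = x + (1 - t) *: z.
  by rewrite xE /z; apply: row2P; rewrite !mxE; ring.
clearbody z.
have x0 : x != 0 by apply/eqP => x0; move: x1; rewrite x0 norm_zero; lra.
(* Were [z] parallel to [x], one of [y], [y'] would be [x] times a factor above 1. *)
have xz : wedge x z != 0.
  apply/eqP => /(parallel_wedge x0); set k := (_ / _) => zk.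
  have k0 : k != 0 by apply: contra z0 => /eqP k0; rewrite zk k0 scale0r.
  have : N ((1 - t * k) *: x) <= 1 by rewrite scalerBl scale1r -scalerA -zk -yE.
  have : N ((1 + (1 - t) * k) *: x) <= 1.
    by rewrite scalerDl scale1r -scalerA -zk -y'E.
  rewrite !is_normZ // x1 !mulr1 !ler_norml => /andP[_ h] /andP[_ h'].
  by move: k0; rewrite neq_lt => /orP[]; nra.
split=> // p.
(* [x] is a convex combination of [x + s *: z] and the end of the chord on the other side, which has
   norm at most 1. *)
have line s : 1 <= N (x + s *: z).
  have [s0|s0] := leP 0 s.
    have : N ((s + t) *: x) <= s * N y + t * N (x + s *: z).
      rewrite (_ : _ *: x = s *: y + t *: (x + s *: z)); last first.
        by rewrite yE; apply: row2P; rewrite !mxE; ring.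
      by apply: norm_comb => //; exact: ltW.
    rewrite (@norm_pos_scale (s + t)) ?addr_ge0 // ?(ltW t0) // x1; nra.
  have : N ((1 - t - s) *: x) <= - s * N y' + (1 - t) * N (x + s *: z).
    rewrite (_ : _ *: x = - s *: y' + (1 - t) *: (x + s *: z)); last first.
      by rewrite y'E; apply: row2P; rewrite !mxE; ring.
    by apply: norm_comb => //; lra.
  rewrite (@norm_pos_scale (1 - t - s)); last lra.
  rewrite x1; nra.
have [->|pz] := eqVneq (wedge p z) 0.
  by rewrite normr0 mulr_ge0 ?norm_ge0.
have [s ps] : exists s, (wedge x z / wedge p z) *: p = x + s *: z.
  exists (wedge x p / wedge p z); apply: row2P; rewrite !mxE;
    move: pz; rewrite /wedge => pz; field; exact: pz.
have := line s; rewrite -ps is_normZ // normrM normfV.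
by rewrite mulrAC ler_pdivlMr ?normr_gt0 // mul1r.
Qed.

(** Ball points averaging to a point of a supporting line lie on that line themselves, where the
    maximality of [s] makes them coincide. *)
Lemma end_of_face_vertex x z s : N x = 1 -> wedge x z != 0 ->
  (forall p, `|wedge p z| <= `|wedge x z| * N p) ->
  N (x + s *: z) <= 1 -> (forall s', N (x + s' *: z) <= 1 -> s' <= s) ->
  vertices N (x + s *: z).
Proof.
move=> x1 xz supp ps smax; split => // y y' t y1 y'1 /andP[t0 t1] pE.
have [yz y'z] : wedge y z = wedge x z /\ wedge y' z = wedge x z.
  have := congr1 (wedge^~ z) pE; rewrite !wedgeE mulr0 addr0 => xE.
  have hy : `|wedge y z| <= `|wedge x z|.
    by rewrite (le_trans (supp y)) // ler_piMr.
  have hy' : `|wedge y' z| <= `|wedge x z|.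
    by rewrite (le_trans (supp y')) // ler_piMr.
  move: hy hy'; rewrite !ler_norml.
  move: xz; rewrite neq_lt => /orP[h|h];
    rewrite ?(ltr0_norm h) ?(gtr0_norm h) => /andP[? ?] /andP[? ?]; split; nra.
have online p : wedge p z = wedge x z -> exists s, p = x + s *: z.
  move=> pz; exists (wedge x p / wedge x z).
  by rewrite [LHS](wedge_decomposition p xz) pz divff // scale1r.
have [sy yE] := online y yz; have [sy' y'E] := online y' y'z.
have ley : sy <= s by apply: smax; rewrite -yE.
have ley' : sy' <= s by apply: smax; rewrite -y'E.
have sE : s = (1 - t) * sy + t * sy'.
  have := congr1 (wedge x) pE; rewrite yE y'E !wedgeE !add0r => e.
  by apply: (mulIf xz); rewrite e; ring.
have [e e'] : sy = s /\ sy' = s by split; nra.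
by rewrite yE y'E e e'.
Qed.

(* [w] is the vertex following [v] counterclockwise: [N] is linear on the cone
   spanned by the two vertices. *)
Definition next_vertex v w := [/\ vertices N v, vertices N w, 0 < wedge v w &
  forall a b, 0 <= a -> 0 <= b -> N (a *: v + b *: w) = a + b].

(** The face through a point that is not extreme runs along a supporting line; its last ball points
    in both directions are the two vertices. *)
Lemma nonvertex_between x : N x = 1 -> ~ vertices N x ->
  exists p q a b, [/\ next_vertex p q, 0 < a, 0 < b & x = a *: p + b *: q].
Proof.
move=> x1 nVx.
have [y [y' [t [y1 y'1 t01 xE yy']]]] : exists y y' t,
    [/\ N y <= 1, N y' <= 1, 0 < t < 1, x = (1 - t) *: y + t *: y' & y' - y != 0].
  apply: contrapT => h; apply: nVx; split => [|y y' t y1 y'1 t01 xE].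
    by rewrite /unit_ball /= x1.
  have [/eqP|yy'] := eqVneq (y' - y) 0; last by exfalso; apply: h; exists y, y', t.
  rewrite subr_eq0 => /eqP yy'; move: xE; rewrite yy' -scalerDl subrK scale1r.
  by move=> ->.
(* Exchanging [y] and [y'] makes the chord run counterclockwise. *)
wlog xz : y y' t y1 y'1 t01 xE yy' / 0 < wedge x (y' - y).
  move=> base; have [xz _] := supporting_line x1 y1 y'1 t01 xE yy'.
  have [h|h] := ltP 0 (wedge x (y' - y)); first exact: (base y y' t).
  apply: (base y' y (1 - t)); rewrite ?y1 ?y'1 //.
  - lra.
  - by rewrite xE; apply: row2P; rewrite !mxE; ring.
  - by rewrite -opprB oppr_eq0.
  - by rewrite -opprB wedgeNr oppr_gt0 lt_neqAle xz h.
have [_ supp] := supporting_line x1 y1 y'1 t01 xE yy'.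
move: t01 => /andP[t0 t1].
move: y1 y'1 ; set z := y' - y in xz yy' supp.
have -> : y = x + t *: (- z) by rewrite xE /z; apply: row2P; rewrite !mxE; ring.
have -> : y' = x + (1 - t) *: z.
  by rewrite xE /z; apply: row2P; rewrite !mxE; ring.
clearbody z => y1 y'1.
have Nz0 : - z != 0 by rewrite oppr_eq0.
have x1' : N x <= 1 by rewrite x1.
have [s s1 smax] := last_ball_point x1' yy'.
have [r r1 rmax] := last_ball_point x1' Nz0.
have s0 : 0 < s by have := smax _ y'1; lra.
have r0 : 0 < r by have := rmax _ y1; lra.
have suppN p : `|wedge p (- z)| <= `|wedge x (- z)| * N p.
  by rewrite !wedgeNr !normrN.
exists (x + r *: - z), (x + s *: z), (s / (r + s)), (r / (r + s)).
split; [|by rewrite divr_gt0 // addr_gt0..|]; last first.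
  by apply: row2P; rewrite !mxE; field; rewrite lt0r_neq0 ?addr_gt0.
split.
- by apply: end_of_face_vertex => //; rewrite wedgeNr oppr_eq0 lt0r_neq0.
- by apply: end_of_face_vertex => //; rewrite lt0r_neq0.
- rewrite !wedgeE (wedgeC z x); nra.
move=> a b a0 b0; apply/eqP; rewrite eq_le; apply/andP; split.
  by rewrite (le_trans (norm_comb _ _ _ _)) // lerD // ler_piMr.
(* Both ends have the same [wedge] with [z] as [x], so the supporting line gives the lower bound
   [a + b]. *)
have := supp (a *: (x + r *: - z) + b *: (x + s *: z)).
rewrite !wedgeE !mulr0 ?oppr0 ?mulr0 !addr0 -mulrDl normrM.
rewrite (ger0_norm (addr_ge0 a0 b0)) mulrC.
by rewrite ler_pM2l // normr_gt0 lt0r_neq0.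
Qed.

(** A point of norm below 1 is the midpoint of a short segment in the ball; any nonzero direction
    [y] serves. *)
Lemma vertex_norm v : vertices N v -> N v = 1.
Proof.
move=> [v1 ext]; apply/eqP; rewrite eq_le v1 /= leNgt; apply/negP => lt1.
pose y : 'rV[R]_2 := const_mx 1.
have y0 : y != 0.
  by apply/eqP => /matrixP/(_ 0 0); rewrite !mxE => /eqP; rewrite oner_eq0.
have Ny := norm_gt0 y0; pose d := (1 - N v) / N y.
have d0 : 0 < d by rewrite divr_gt0 ?subr_gt0.
have near e : `|e| = d -> N (v + e *: y) <= 1.
  move=> eE; rewrite (le_trans (is_normD normN _ _)) // is_normZ // eE /d.
  by rewrite divfK ?lt0r_neq0 // addrC subrK.
have [||||_ /eqP] := ext (v + - d *: y) (v + d *: y) (1 / 2).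
- by apply: near; rewrite normrN gtr0_norm.
- by apply: near; rewrite gtr0_norm.
- lra.
- by apply: row2P; rewrite !mxE; field.
by rewrite -subr_eq0 addrAC subrr add0r scaler_eq0 (negbTE y0) gt_eqF.
Qed.

End NormedPlane.

(** * Consecutive vertices of a polygonal ball *)

Section PolygonalNorm.
Context {R : realType} (N : 'rV[R]_2 -> R) (normN : is_norm N).
Implicit Types (u v w x y z p q : 'rV[R]_2) (a b t : R).

Lemma vertex_opp v : vertices N v -> vertices N (- v).
Proof.
move=> [v1 ext]; split => [|y z t y1 z1 t01 e].
  by rewrite /unit_ball /= norm_opp.
have [||||yv zv] := ext (- y) (- z) t; rewrite /unit_ball /= ?norm_opp //.
  by rewrite -[v]opprK e; apply: row2P; rewrite !mxE; ring.
by rewrite -[y]opprK yv -[z]opprK zv.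
Qed.

Lemma next_vertex_opp v w : next_vertex N v w -> next_vertex N (- v) (- w).
Proof.
move=> [Vv Vw vw lin]; split => [||| a b a0 b0]; try exact: vertex_opp.
  by rewrite !wedgeE opprK.
by rewrite !scalerN -opprD norm_opp // lin.
Qed.

(** For small [t], the vector v + w + t y stays in the cone where [N] is linear; the triangle
    inequality then bounds the linear form at [y] by [N y]. *)
Lemma next_vertex_support v w y : next_vertex N v w ->
  wedge y (w - v) <= wedge v w * N y.
Proof.
move=> [_ _ vw lin].
have := wedge_decomposition y (lt0r_neq0 vw).
set a := (X in X *: v) ; set b := (X in X *: w) => yE.
have -> : wedge y (w - v) = wedge v w * (a + b).
  rewrite /a /b -mulrDl mulrCA divff ?lt0r_neq0 // mulr1 !wedgeE (wedgeC y v).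
  by rewrite opprK.
rewrite ler_pM2l //; pose t := (1 + `|a| + `|b|)^-1.
have t0 : 0 < t by rewrite invr_gt0 -addrA ltr_pwDl // addr_ge0.
have small c : `|c| <= `|a| + `|b| -> 0 <= 1 + t * c.
  move=> h; have : 0 <= t * (1 + `|a| + `|b| + c).
    by rewrite mulr_ge0 ?ltW //; have := lerNnormlW h; lra.
  by rewrite mulrDr mulVf // lt0r_neq0 // -invr_gt0.
have /eqP : N ((1 + t * a) *: v + (1 + t * b) *: w) = 2 + t * (a + b).
  rewrite lin ?small ?lerDl ?lerDr //; ring.
rewrite (_ : _ + _ *: w = (1 *: v + 1 *: w) + t *: y); last first.
  by rewrite yE; apply: row2P; rewrite !mxE; ring.
move=> /eqP e; have := is_normD normN (1 *: v + 1 *: w) (t *: y).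
by rewrite e lin // norm_pos_scale ?(ltW t0) // lerD2l ler_pM2l.
Qed.

(** Of two distinct vertices on the ray, the nearer would lie strictly between [p] and the
    farther. *)
Lemma vertices_on_ray p u v t : N p <= 1 -> vertices N u -> vertices N v ->
  0 < t -> v = (1 - t) *: p + t *: u -> u = v.
Proof.
move=> p1 [u1 extu] [v1 extv] t0 vE.
have [t1|t1|t1] := ltgtP t 1; last first.
- by rewrite vE t1 subrr scale0r add0r scale1r.
- have [||_ -> //] := extu p v t^-1 p1 v1.
    by rewrite invr_gt0 t0 invf_lt1.
  by rewrite vE; apply: row2P; rewrite !mxE; field; rewrite lt0r_neq0.
- by have [|] := extv p u t p1 u1 _ vE; rewrite ?t0.
Qed.

(** The support inequalities of the two edges are opposite, so equality holds and [w'] lies on the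
    ray from [v] through [w]. *)
Lemma next_vertex_inj v w w' : next_vertex N v w -> next_vertex N v w' -> w = w'.
Proof.
move=> nw nw'; have h := next_vertex_support w' nw.
have h' := next_vertex_support w nw'.
case: nw nw' => [Vv Vw vw _] [_ Vw' vw' _].
move: h h'; rewrite !(vertex_norm normN) // !wedgeE.
rewrite (wedgeC w' w) (wedgeC w' v) (wedgeC w v).
move=> h h'; apply: (vertices_on_ray (p := v) (t := wedge v w' / wedge v w)) => //.
- by rewrite (vertex_norm normN).
- by rewrite divr_gt0.
rewrite [LHS](wedge_decomposition w' (lt0r_neq0 vw)); congr (_ *: _ + _).
have -> : wedge w' w = wedge v w - wedge v w' by rewrite (wedgeC w' w); lra.
by rewrite mulrBl divff // lt0r_neq0.
Qed.

Lemma prev_vertex_inj v v' w : next_vertex N v w -> next_vertex N v' w -> v = v'.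
Proof.
move=> nw nw'; have h := next_vertex_support v' nw.
have h' := next_vertex_support v nw'.
case: nw nw' => [Vv Vw vw _] [Vv' _ vw' _].
move: h h'; rewrite !(vertex_norm normN) // !wedgeE (wedgeC v' v).
move=> h h'; apply: (vertices_on_ray (p := w) (t := wedge v' w / wedge v w)) => //.
- by rewrite (vertex_norm normN).
- by rewrite divr_gt0.
rewrite [LHS](wedge_decomposition v' (lt0r_neq0 vw)) addrC; congr (_ *: _ + _).
have -> : wedge v v' = wedge v w - wedge v' w by lra.
by rewrite mulrBl divff // lt0r_neq0.
Qed.

(** The support inequality of the first edge gives the weak inequality; equality would put [v]
    strictly between [u] and [w]. *)
Lemma next_vertex_turn u v w : next_vertex N u v -> next_vertex N v w ->
  0 < wedge (v - u) (w - v).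
Proof.
move=> nuv nvw; have h := next_vertex_support w nuv.
case: nuv nvw => [Vu Vv uv _] [_ Vw vw _]; move: h.
rewrite (vertex_norm normN) // lt_neqAle => h; apply/andP; split; last first.
  by move: h; rewrite !wedgeE (wedgeC w v) (wedgeC w u); lra.
apply/negP => /eqP flat.
have {}flat : wedge u w = wedge u v + wedge v w by move: flat; rewrite !wedgeE; lra.
have := wedge_decomposition w (lt0r_neq0 uv); rewrite flat (wedgeC w v) => wE.
have [_ /(_ u w (wedge u v / (wedge u v + wedge v w)))[]] := Vv.
- by case: Vu.
- by case: Vw.
- have uvw := addr_gt0 uv vw.
  by rewrite divr_gt0 //= ltr_pdivrMr // mul1r ltrDl.
- move: uv vw wE; move: (wedge u v) (wedge v w) => c d c0 d0 ->.
  have cd := addr_gt0 c0 d0.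
  by apply: row2P; rewrite !mxE; field; rewrite !lt0r_neq0.
by move=> e; move: uv; rewrite e wedgexx ltxx.
Qed.

Lemma next_vertex_cone p q y : next_vertex N p q ->
  0 <= wedge p y -> wedge q y < 0 ->
  exists a b, [/\ 0 < a, 0 <= b & y = a *: p + b *: q].
Proof.
move=> [_ _ pq _] py qy.
exists (wedge y q / wedge p q), (wedge p y / wedge p q); split.
- by rewrite divr_gt0 // wedgeC oppr_gt0.
- by rewrite divr_ge0 // ltW.
- by apply: wedge_decomposition; rewrite lt0r_neq0.
Qed.

(** By linearity of [N] on the cone, [v] is a convex combination of [p] and [q] with positive weight
    on [p]; extremality leaves only [p]. *)
Lemma next_vertex_cone_vertex p q v : next_vertex N p q -> vertices N v ->
  0 <= wedge p v -> wedge q v < 0 -> p = v.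
Proof.
move=> npq Vv pv qv; have [a [b [a0 b0 vE]]] := next_vertex_cone npq pv qv.
case: (npq) => [Vp Vq _ lin].
have ab : a + b = 1 by rewrite -(vertex_norm normN Vv) vE lin // ltW.
have [b0'|b0'] := eqVneq b 0.
  by rewrite vE b0' scale0r addr0 -[a]addr0 -b0' ab scale1r.
have bpos : 0 < b by rewrite lt_neqAle eq_sym b0'.
have [_ /(_ p q b)[]//] := Vv.
- by case: Vp.
- by case: Vq.
- lra.
- by rewrite vE -ab addrK.
Qed.

(** Finitely many strict inequalities survive a common small perturbation; this serves to leave a
    vertex without passing the direction of another. *)
Lemma small_scale (T : eqType) (s : seq T) (f g : T -> R) :
  exists2 t, 0 < t & forall i, i \in s -> 0 < f i -> t * g i < f i.
Proof.
elim: s => [|i s [t t0 IH]]; first by exists 1.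
have [fi|fi] := ltP 0 (f i); last first.
  exists t => // j; rewrite inE => /predU1P[->|/IH//]; by rewrite ltNge fi.
have h : 0 < f i / (1 + `|g i|) by rewrite divr_gt0 // ltr_pwDl.
exists (Num.min t (f i / (1 + `|g i|))); first by rewrite lt_min t0.
move=> j; rewrite inE => /predU1P[-> _|js fj]; set m := Num.min _ _.
  have m0 : 0 < m by rewrite lt_min t0.
  have : m <= f i / (1 + `|g i|) by rewrite ge_min lexx orbT.
  rewrite ler_pdivlMr ?ltr_pwDl // => hm.
  have := ler_norm (g i); nra.
have m0 : 0 < m by rewrite lt_min t0.
have mt : m <= t by rewrite ge_min lexx.
have := IH _ js fj; have [g0|g0] := leP 0 (g j); nra.
Qed.

Lemma next_vertex_exists v : is_polygon N -> vertices N v ->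
  exists w, next_vertex N v w.
Proof.
move=> /finite_seqP[s sE] Vv; have N1 := vertex_norm normN Vv.
have v0 : v != 0.
  by apply/eqP => v0; have := norm_zero normN; rewrite -v0 N1; lra.
(* A point of the sphere just after [v]: no vertex lies strictly between. *)
have [t t0 small] := small_scale s (wedge v) (wedge^~ (quarter_turn v)).
pose x := v + t *: quarter_turn v.
have vx : 0 < wedge v x.
  by rewrite /x !wedgeE add0r wedge_quarter_turn mulr_gt0 // euclid_dot_gt0.
have after p : vertices N p -> 0 < wedge v p -> wedge p x < 0.
  move=> Vp vp; rewrite /x !wedgeE (wedgeC p v) addrC subr_lt0; apply: small => //.
  by move: Vp; rewrite sE.
clearbody x.
have x0 : x != 0 by apply/eqP => x0; move: vx; rewrite wedgeC x0 wedge0l oppr0 ltxx.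
have Nx := norm_gt0 normN x0.
have x'1 : N ((N x)^-1 *: x) = 1.
  by rewrite norm_pos_scale // ?invr_ge0 ?(ltW Nx) // mulVf // lt0r_neq0.
have [|p [q [a [b [npq a0 b0 x'E]]]]] := nonvertex_between normN x'1.
  move=> /after; rewrite wedgeZr wedgeZl wedgexx mulr0 ltxx => h.
  by have := h (mulr_gt0 _ vx); rewrite invr_gt0 => /(_ Nx).
case: (npq) => [Vp Vq pq lin].
have xE : x = (N x * a) *: p + (N x * b) *: q.
  by rewrite -!scalerA -scalerDr -x'E scalerA divff ?scale1r // lt0r_neq0.
have {}a0 : 0 < N x * a by rewrite mulr_gt0.
have {}b0 : 0 < N x * b by rewrite mulr_gt0.
move: xE a0 b0; set a' := N x * a; set b' := N x * b => xE a0 b0.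
have px : 0 < wedge p x by rewrite xE !wedgeE mulr0 add0r mulr_gt0.
suff pv : p = v by exists q; rewrite -pv.
(* If [p] came after [v], it would also come after [x]; if before, [v] would be a vertex in the cone
   from [p] to [q]; on the line of [v], norm and orientation decide. *)
have [vp|vp|vp] := ltgtP 0 (wedge v p).
- by have := lt_trans px (after p Vp vp); rewrite ltxx.
- have qv : wedge q v < 0.
    have : wedge v x = a' * wedge v p + b' * wedge v q by rewrite xE !wedgeE.
    by rewrite (wedgeC q v) oppr_lt0 => e; rewrite -(pmulr_rgt0 _ b0); nra.
  by apply: (next_vertex_cone_vertex npq) => //; rewrite wedgeC; lra.
- have := parallel_wedge v0 (esym vp); set k := (_ / _) => pE.
  have k1 : `|k| = 1.
    by rewrite -(vertex_norm normN Vp) pE (is_normZ normN) // N1 mulr1.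
  have k0 : 0 < k by rewrite -(pmulr_lgt0 _ vx) -wedgeZl -pE.
  by rewrite pE -[k]gtr0_norm // k1 scale1r.
Qed.

Lemma next_vertex_edge v w : next_vertex N v w -> edge N v w /\ edge N w v.
Proof.
move=> [Vv Vw vw lin].
have neq : v <> w by move=> e; move: vw; rewrite e wedgexx ltxx.
split; split => //; try exact: nesym.
  move=> _ [t /= /itvP t01 <-]; rewrite /unit_sphere /= lin ?t01 ?subrK //.
  by rewrite subr_ge0 t01.
move=> _ [t /= /itvP t01 <-]; rewrite /unit_sphere /= addrC lin ?t01 ?subrK //.
  by rewrite addrC subrK.
by rewrite subr_ge0 t01.
Qed.

(* The two conditions say that the polar of the unit disk with respect to
   [wedge] is a multiple of the disk itself. *)
Lemma radon_of_self_polar (C : R) : 0 < C ->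
  (forall x y, `|wedge x y| <= C * N x * N y) ->
  (forall y, exists2 v, N v = 1 & `|wedge v y| = C * N y) ->
  radon_plane N.
Proof.
move=> C0 bound attained x y xy.
have [->|x0] := eqVneq x 0.
  by move=> l; rewrite scaler0 addr0.
have [->|y0] := eqVneq y 0.
  by move=> l; rewrite add0r (norm_zero normN) // norm_ge0.
have Ny := norm_gt0 normN y0; have Nx := norm_gt0 normN x0.
have [v v1 vy] := attained y.
have vy0 : wedge v y != 0 by rewrite -normr_gt0 vy mulr_gt0.
(* Orthogonality is tested at the [l] that makes [x + l *: y] a multiple of [v]. *)
have eq_xy : C * N x * N y <= `|wedge x y|.
  have xE := wedge_decomposition x vy0.
  have := xy (- (wedge v x / wedge v y)).
  rewrite {2}xE -addrA -scalerDl subrr scale0r addr0 (is_normZ normN) // v1 mulr1.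
  rewrite normrM normfV vy ler_pdivlMr ?mulr_gt0 //.
  by rewrite mulrCA mulrA.
(* Adding a multiple of [x] to [y] does not change [wedge x y]. *)
move=> l; rewrite -(ler_pM2l (mulr_gt0 C0 Nx)) (le_trans eq_xy) //.
have := bound x (y + l *: x).
by rewrite !wedgeE mulr0 addr0.
Qed.

End PolygonalNorm.

(** * Rotational symmetry and cyclic order of the vertices *)

Section RegularPolygon.
Context {R : realType} (N : 'rV[R]_2 -> R) (normN : is_norm N).
Implicit Types (u v w x y z p q : 'rV[R]_2) (a b t : R).

Lemma regular_polygon_rotation : is_regular_polygon N ->
  exists c s : R, c ^+ 2 + s ^+ 2 = 1 /\
    forall u v w, next_vertex N u v -> next_vertex N v w ->
      w - v = rotation c s (v - u).
Proof.
move=> [_ [len lenE] [a aE]].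
have cos1 : 0 <= 1 - cos a ^+ 2 by rewrite -(cos2Dsin2 a) addrAC subrr add0r sqr_ge0.
(* Edges turn by the exterior angle [pi - a], of cosine [- cos a]; the counterclockwise turn selects
   the nonnegative sine. *)
exists (- cos a), (Num.sqrt (1 - cos a ^+ 2)); split => [|u v w nuv nvw].
  by rewrite sqr_sqrtr // sqrrN addrC subrK.
have [euv evu] := next_vertex_edge nuv.
have [evw _] := next_vertex_edge nvw.
have turn := next_vertex_turn normN nuv nvw.
have uw : u <> w.
  move=> uw; case: nuv nvw => _ _ uv _ [_ _ vw _].
  by move: vw; rewrite -uw (wedgeC v u) oppr_gt0 => /(lt_trans uv); rewrite ltxx.
have := aE _ _ _ evu evw uw.
have e0 : v - u != 0 by apply: wedge_neq0l (lt0r_neq0 turn).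
have := euclid_dot_gt0 e0.
have dotN : euclid_dot (u - v) (w - v) = - euclid_dot (v - u) (w - v).
  by rewrite !euclid_dotE !mxE; ring.
have sq x : 0 <= euclid_dot x x -> euclid_norm x = len -> euclid_dot x x = len ^+ 2.
  by move=> x0 <-; rewrite sqr_sqrtr.
have dot_ge0 x : 0 <= euclid_dot x x.
  by rewrite euclid_dotE -!expr2 addr_ge0 // sqr_ge0.
have ee := sq _ (dot_ge0 _) (lenE _ _ euv).
have ff := sq _ (dot_ge0 _) (lenE _ _ evw).
have := lagrange_identity (v - u) (w - v).
have := dot_wedge_rotation (w - v) e0.
rewrite /angle dotN (lenE _ _ evw) (lenE _ _ evu) -expr2 ee ff.
move: turn; move: (w - v) (v - u) => f e.
set W := wedge e f; set D := euclid_dot e f => W0 fE lag L0.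
set L := len ^+ 2 in fE lag L0 * => acosE.
have bnd : -1 <= - D / L <= 1.
  rewrite -ler_norml normrM normrN normfV (gtr0_norm L0).
  rewrite ler_pdivrMr // mul1r -(ger0_norm (ltW L0)) -ler_sqr ?nnegrE //.
  by rewrite !real_normK ?num_real // [L ^+ 2]expr2 -lag lerDr sqr_ge0.
have cosE : cos a = - D / L by rewrite -acosE acosK // in_itv.
rewrite fE cosE mulNr opprK; congr (rotation _ _ _).
rewrite sqrrN -[LHS]gtr0_norm ?divr_gt0 // -sqrtr_sqr; congr (Num.sqrt _).
have L0' := lt0r_neq0 L0.
apply: (mulIf (expf_neq0 2 L0')); rewrite [RHS]mulrBl mul1r -!exprMn !divfK //.
by rewrite [L ^+ 2]expr2 -lag addrK.
Qed.

(* The vertices in counterclockwise order; by [cyclic_sweep] the successor map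
   has a single orbit. *)
Lemma vertex_cycle m : (0 < m)%N -> is_polygon N -> vertices N #= `I_m ->
  exists A : nat -> 'rV[R]_2,
    [/\ forall k, next_vertex N (A k) (A k.+1),
        forall k, A (k + m)%N = A k,
        forall p, vertices N p -> exists2 k, (k < m)%N & A k = p &
        forall k l, (k < m)%N -> (l < m)%N -> A k = A l -> k = l].
Proof.
move=> m0 polyN /card_set_bijP[f [fV finj fsurj]].
have /choice[phi phiP] (i : 'I_m) : exists p, vertices N p /\ f p = i.
  by have [p Vp fp] := fsurj i (ltn_ord i); exists p.
have phiV i : vertices N (phi i) by case: (phiP i).
have phi_inj : injective phi.
  by move=> i j e; apply: val_inj; rewrite /= -(phiP i).2 e (phiP j).2.
have phi_surj p : vertices N p -> exists i, phi i = p.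
  move=> Vp; exists (Ordinal (fV p Vp)).
  by apply: finj; rewrite ?inE //; exact: (phiP _).2.
have /choice[sigma sigmaP] (i : 'I_m) : exists j, next_vertex N (phi i) (phi j).
  have [w nw] := next_vertex_exists normN polyN (phiV i).
  have [_ /phi_surj[j jw] _ _] := nw; by exists j; rewrite jw.
(* Injectivity makes the orbit of [i0] a closed cycle. *)
have sigma_inj : injective sigma.
  move=> i j e; apply: phi_inj; apply: (prev_vertex_inj normN (sigmaP i)).
  by rewrite e.
pose i0 := Ordinal m0; pose A k := phi (iter k sigma i0).
have next k : next_vertex N (A k) (A k.+1) by exact: sigmaP.
pose r := order sigma i0.
have per k : A (k + r)%N = A k by rewrite /A iterD iter_order.
(* Sweeping towards [phi j] finds an orbit member whose half-open cone contains this vertex, hence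
   equals it. *)
have conn j : fconnect sigma i0 j.
  have p0 : phi j != 0.
    apply/eqP => e; have := norm_zero normN; rewrite -e.
    by rewrite (vertex_norm normN) // => /eqP; rewrite oner_eq0.
  have [|k [k1 k2]] := cyclic_sweep (order_gt0 sigma i0) per _ p0.
    by move=> k; case: (next k).
  have /phi_inj <- := next_vertex_cone_vertex normN (next k) (phiV j) k1 k2.
  exact: fconnect_iter.
have rm : r = m by rewrite -[RHS]card_ord; apply: eq_card => j; exact: conn.
exists A; split => //; first by move=> k; rewrite -rm.
  move=> p /phi_surj[j <-]; exists (findex sigma i0 j).
    by have := findex_max (conn j); rewrite [order _ _]rm.
  by rewrite /A iter_findex.
move=> k l km lm /phi_inj e; rewrite -[m]rm in km lm.
by rewrite -(findex_iter km) e findex_iter.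
Qed.

End RegularPolygon.

(** * Edges parallel to vertices, and self-polarity of the ball *)

Theorem theorem2p7 (R : realType) (N : 'rV[R]_2 -> R) (n : nat)
  (normN : is_norm N) (n_gt0 : (0 < n)%N)
  (regN : is_regular_polygon N)
  (vertN : vertices N #= `I_(4 * n + 2)%N) :
  radon_plane N.
Proof.
have polyN : is_polygon N by case: regN.
have m0 : (0 < 4 * n + 2)%N by rewrite addn_gt0 orbT.
have [A [next per surj inj]] := vertex_cycle normN m0 polyN vertN.
have [c [s [cs rot]]] := regular_polygon_rotation normN regN.
have turn k : 0 < wedge (A k) (A k.+1) by case: (next k).
have VA k : vertices N (A k) by case: (next k).
have A0 : A 0%N != 0 by apply: wedge_neq0l (lt0r_neq0 (turn 0%N)).
have [h hm hE] := surj _ (vertex_opp normN (VA 0%N)).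
(* [Q (A k) - A k.+1] does not depend on [k] and changes sign under [h], so the
   center of the rotation is the origin. *)
have step k : A k.+1 = rotation c s (A k).
  pose d k := rotation c s (A k) - A k.+1.
  have dS j : d j.+1 = d j.
    have := rot _ _ _ (next j) (next j.+1).
    rewrite rotationD rotationN /d => /eqP; rewrite subr_eq => /eqP ->.
    by rewrite opprD opprB addrA addrCA subrr addr0.
  have dE j : d j = d 0%N by elim: j => // j <-.
  have hSE : A h.+1 = - A 1%N.
    apply: (next_vertex_inj normN (next h)); rewrite hE.
    exact: next_vertex_opp.
  have d0 : d 0%N = 0.
    have /eqP : d 0%N = - d 0%N.
      by rewrite -[LHS](dE h) /d hE hSE rotationN [RHS]opprB opprK addrC.
    by rewrite -addr_eq0 -mulr2n -scaler_nat scaler_eq0 pnatr_eq0 => /eqP.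
  by apply/eqP; rewrite eq_sym -subr_eq0 -/(d k) dE d0.
have iterA k l : A (k + l)%N = iter l (rotation c s) (A k).
  by elim: l => [|l IH]; rewrite ?addn0 // addnS step IH.
(* A rotation that reverses [A 0] is -1. *)
have antipode k : A (k + h)%N = - A k.
  have [a [b [_ abE]]] := iter_rotation h cs.
  have [aE bE] : a = -1 /\ b = 0.
    by apply: (rotation_opp A0); rewrite -abE -iterA add0n.
  by rewrite iterA abE aE bE; apply: row2P; rewrite !mxE; ring.
(* [h + h] is a multiple of the period 4n+2 and less than twice it; it is not 0, since [A 0] differs
   from its opposite. *)
have h2n1 : h = (2 * n + 1)%N.
  have hh : A (h + h)%N = A 0%N by rewrite antipode hE opprK.
  have [small|large] := ltnP (h + h) (4 * n + 2).
    have h0 : h = 0%N by have := inj _ _ small m0 hh; lia.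
    move: hE => /eqP; rewrite h0 -addr_eq0 -mulr2n -scaler_nat scaler_eq0 pnatr_eq0.
    by rewrite (negbTE A0).
  have : (h + h - (4 * n + 2) = 0)%N.
    by apply: inj => //; [lia|rewrite -per subnK].
  lia.
have [a [b [ab abE]]] := iter_rotation n.+1 cs.
pose kappa := - (2 * a).
(* With [P] the rotation by [n + 1] steps, [P ^ 2 = - Q] because the antipode is
   [2 n + 1] steps away; Cayley-Hamilton [P ^ 2 - 2 a P + 1 = 0] then makes the
   edge [Q - 1] a multiple of [P]. *)
have edgeE k : A k.+1 - A k = kappa *: A (k + n.+1)%N.
  have e : A k.+1 = - rotation a b (rotation a b (A k)).
    rewrite -!abE -iterD -iterA.
    have -> : (k + (n.+1 + n.+1) = k.+1 + h)%N by lia.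
    by rewrite antipode opprK.
  have bb : b ^+ 2 = 1 - a ^+ 2 by rewrite -ab addrAC subrr add0r.
  by rewrite e iterA abE /kappa; apply: row2P; rewrite !mxE /=; ring: bb.
clearbody kappa.
pose D := wedge (A 0%N) (A 1%N).
have D0 : 0 < D by exact: turn.
have DE k : wedge (A k) (A k.+1) = D.
  by elim: k => // k <-; rewrite {1}(step k) (step k.+1) wedge_rotation.
have kappa0 : kappa != 0.
  apply/eqP => k0; have := edgeE 0%N; rewrite k0 scale0r => /eqP.
  by rewrite subr_eq0 => /eqP e; move: D0; rewrite /D e wedgexx ltxx.
have cone x : x != 0 -> exists k a b,
    [/\ 0 <= a, 0 <= b, x = a *: A k + b *: A k.+1 & N x = a + b].
  move=> x0; have [k [k1 k2]] := cyclic_sweep m0 per turn x0.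
  have [a' [b' [a0 b0 xE]]] := next_vertex_cone (next k) k1 k2.
  exists k, a', b'; split => //; first exact: ltW.
  by rewrite xE; case: (next k) => _ _ _ -> //; exact: ltW.
have kappaN : 0 < `|kappa| by rewrite normr_gt0.
have bound y k : `|kappa| * `|wedge y (A k)| <= D * N y.
  (* [k + 3 * n + 1] is k - (n+1) modulo 4n+2, so the edge starting there is [kappa *: A k]. *)
  have kE : A k = A (k + 3 * n + 1 + n.+1)%N by rewrite -per; congr A; lia.
  rewrite -normrM -wedgeZr kE -edgeE ler_norml.
  have := next_vertex_support normN y (next (k + 3 * n + 1)%N).
  have := next_vertex_support normN (- y) (next (k + 3 * n + 1)%N).
  by rewrite DE wedgeNl norm_opp // lerNl => -> ->.
apply: (@radon_of_self_polar _ _ normN (D / `|kappa|)).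
- by rewrite divr_gt0.
(* [bound] extends from the vertices to [x] because [N] is linear on the cone containing [x]. *)
- move=> x y; have [->|/cone[k [a' [b' [a0 b0 xE ->]]]]] := eqVneq x 0.
    by rewrite wedge0l normr0 norm_zero // mulr0 mul0r.
  rewrite -(ler_pM2l kappaN) !mulrA [`|kappa| * D]mulrC mulfK ?lt0r_neq0 //.
  rewrite xE !wedgeE (le_trans (ler_wpM2l _ (ler_normD _ _))) //.
  rewrite !normrM (ger0_norm a0) (ger0_norm b0) mulrDr !(mulrCA `|kappa|).
  rewrite (wedgeC (A k)) (wedgeC (A k.+1)) !normrN.
  have := ler_wpM2l a0 (bound y k); have := ler_wpM2l b0 (bound y k.+1).
  lra.
move=> y; have [->|/cone[k [a' [b' [a0 b0 yE Ny]]]]] := eqVneq y 0.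
  exists (A 0%N); first exact: vertex_norm.
  by rewrite wedgeC wedge0l oppr0 normr0 norm_zero // mulr0.
(* This vertex is parallel to the edge spanning the cone of [y], where the support inequality is an
   equality. *)
exists (A (k + n.+1)%N); first exact: vertex_norm.
apply: (mulfI (lt0r_neq0 kappaN)).
rewrite wedgeC normrN -normrM -wedgeZr -edgeE Ny yE !wedgeE.
rewrite (wedgeC (A k.+1)) DE mulrA [`|kappa| * _]mulrC divfK ?lt0r_neq0 //.
rewrite [X in `|X|](_ : _ = D * (a' + b')); last by ring.
by rewrite ger0_norm // mulr_ge0 ?(ltW D0) // addr_ge0.
Qed.
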